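(* The map $A\longmapsto\mathcal{R}_{\mathrm{hc}}(A)$, assigning to each Banach algebra $A$ its largest hypocompact ideal $\mathcal{R}_{\mathrm{hc}}(A)$, is a hereditary topological radical.
   Context: All Banach algebras are over $\mathbb{C}$ and need not be unital; ''ideal'' means closed two-sided ideal. An element $a$ of a Banach algebra $B$ is compact if the operator $x\mapsto axa$ is compact on $B$. A Banach algebra $B$ is hypocompact if every non-zero quotient $B/I$ ($I$ an ideal of $B$) has a non-zero compact element. An ideal is hypocompact if it is hypocompact as a Banach algebra. Every Banach algebra $A$ has a largest hypocompact ideal, denoted $\mathcal{R}_{\mathrm{hc}}(A)$. A hereditary topological radical on the class of all Banach algebras is a map $P$ which assigns to each Banach algebra $A$ an ideal $P(A)$ of $A$ and satisfies: (R1) $P(A/P(A))=0$; (R2) $P(J)=J\cap P(A)$ for any ideal $J$ of $A$; (R3) $f(P(A))\subset P(B)$ for every continuous surjective homomorphism $f:A\to B$ of Banach algebras. *)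

(* Defs.v *)
From HB Require Import structures.
From mathcomp Require Import all_boot all_order all_algebra.
From mathcomp Require Import generic_quotient ring_quotient.
From mathcomp Require Import complex ring lra.
From mathcomp Require Import all_classical all_reals.
From mathcomp Require Import topology normedtype sequences.

Set Implicit Arguments.
Unset Strict Implicit.
Unset Printing Implicit Defensive.

Import Order.TTheory GRing.Theory Num.Theory.
Import numFieldNormedType.Exports.

Local Open Scope classical_set_scope.
Local Open Scope ring_scope.
Local Open Scope complex_scope.
Local Open Scope quotient_scope.

Reserved Notation "x ** y" (at level 40, left associativity).

HB.mixin Record isBanachAlgebra (R : realType) A
    of CompleteNormedModule R[i] A := {
  bmul : A -> A -> A;
  bmulA : associative bmul;
  bmulDl : left_distributive bmul +%R;
  bmulDr : right_distributive bmul +%R;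
  bmulZl : forall (c : R[i]) (x y : A), bmul (c *: x) y = c *: bmul x y;
  bmulZr : forall (c : R[i]) (x y : A), bmul x (c *: y) = c *: bmul x y;
  normr_bmul : forall x y : A, `|bmul x y| <= `|x| * `|y|
}.

#[short(type="banachAlgType")]
HB.structure Definition BanachAlgebra (R : realType) :=
  {A of isBanachAlgebra R A & CompleteNormedModule R[i] A}.

Notation "x ** y" := (bmul x y) : ring_scope.

Definition is_ideal (R : realType) (A : banachAlgType R) (I : set A) : Prop :=
  [/\ closed I, I 0,
      forall x y, I x -> I y -> I (x + y),
      forall (c : R[i]) x, I x -> I (c *: x) &
      forall a x, I x -> I (a ** x) /\ I (x ** a)].

Record ideal (R : realType) (A : banachAlgType R) := Ideal {
  ideal_set :> A -> Prop;
  idealP : is_ideal ideal_set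
}.

(* In a normed module over [R[i]] the norm takes its values in [R[i]];
   [rnorm] is the same norm seen as a real number. *)
Definition rnorm (R : realType) (V : normedModType R[i]) (x : V) : R :=
  complex.Re `|x|.

Lemma Re_norm_ge0 (R : realType) (c : R[i]) : 0 <= complex.Re `|c|.
Proof. by case: c => a b /=; exact: sqrtr_ge0. Qed.

Section RealNorm.
Context (R : realType) (V : normedModType R[i]).
Implicit Types x y : V.

Lemma rnormE x : `|x| = (rnorm x)%:C.
Proof. by apply/esym/RRe_real/normr_real. Qed.

Lemma rnorm_ge0 x : 0 <= rnorm x.
Proof. by rewrite -ler0c -rnormE. Qed.

Lemma rnormD x y : rnorm (x + y) <= rnorm x + rnorm y.
Proof. by rewrite -lecR rmorphD/= -!rnormE ler_normD. Qed.

Lemma rnormZ (c : R[i]) x : rnorm (c *: x) = complex.Re `|c| * rnorm x.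
Proof.
by apply: (@complexI R); rewrite rmorphM/= -!rnormE normrZ; congr (_ * _).
Qed.

Lemma rnormN x : rnorm (- x) = rnorm x.
Proof. by rewrite /rnorm normrN. Qed.

Lemma rnormB x y : rnorm (x - y) = rnorm (y - x).
Proof. by rewrite -rnormN opprB. Qed.

Lemma rnorm_distD z x y : rnorm (x - y) <= rnorm (x - z) + rnorm (z - y).
Proof. by rewrite (le_trans _ (rnormD _ _))// addrA subrK. Qed.

Lemma rnorm0 : rnorm (0 : V) = 0.
Proof. by rewrite /rnorm normr0. Qed.

Lemma rnorm_eq0 x : rnorm x = 0 -> x = 0.
Proof. by move=> x0; apply/normr0_eq0; rewrite rnormE x0. Qed.

Lemma posC (e : R[i]) : 0 < e -> 0 < complex.Re e /\ (complex.Re e)%:C = e.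
Proof.
move=> e0; have eE : (complex.Re e)%:C = e by apply/RRe_real/gtr0_real.
by rewrite -ltcR eE.
Qed.

Lemma nbhs_rnormP x (U : set V) :
  nbhs x U <-> exists2 e : R, 0 < e & forall y, rnorm (x - y) < e -> U y.
Proof.
split=> [/nbhs_normP[e /posC[e0 eE] eU]|[e e0 eU]].
  by exists (complex.Re e) => // y xy; apply: eU; rewrite /ball_/= -eE rnormE ltcR.
apply/nbhs_normP; exists e%:C; first by rewrite /= ltcR.
by move=> y; rewrite /ball_/= rnormE ltcR => /eU.
Qed.

Lemma closed_rnormP (I : set V) : closed I <->
  forall x, (forall e : R, 0 < e -> exists2 y, I y & rnorm (x - y) < e) -> I x.
Proof.
split=> [cI x xI|cI x xI].
  apply: cI => U /nbhs_rnormP[e /xI[y Iy xy] eU].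
  by exists y; split => //; apply: eU.
apply: cI => e e0.
have [|y [Iy xy]] := xI [set y | rnorm (x - y) < e]; last by exists y.
by apply/nbhs_rnormP; exists e.
Qed.

Lemma exp2V_lt (M e : R) : 0 < e -> exists n, M * 2^-1 ^+ n < e.
Proof.
move=> e0; have [M0|M0] := leP M 0.
  by exists 0; rewrite expr0 mulr1 (le_lt_trans M0).
have [n nMe] : exists n : nat, M / e < n%:R.
  by exists (Num.truncn (M / e)).+1; exact: truncnS_gt.
exists n; rewrite exprVn ltr_pdivrMr ?exprn_gt0//.
rewrite ltr_pdivrMr// mulrC in nMe; apply: (lt_le_trans nMe).
by rewrite ler_pM2l// -natrX ler_nat ltnW// ltn_expl.
Qed.

Lemma fast_dist (u : nat -> V) (M : R) :
    (forall n, rnorm (u n.+1 - u n) <= M * 2^-1 ^+ n) ->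
  forall n k, rnorm (u (n + k)%N - u n) <= M * 2 * 2^-1 ^+ n - M * 2 * 2^-1 ^+ (n + k).
Proof.
move=> uM n; elim=> [|k IHk]; first by rewrite addn0 !subrr rnorm0.
rewrite (le_trans (rnorm_distD (u (n + k)%N) _ _))//.
rewrite addnS (le_trans (lerD (uM _) IHk))// exprS.
set a := 2^-1 ^+ (n + k); set b := 2^-1 ^+ n.
have -> : M * 2 * (2^-1 * a) = M * a by field.
lra.
Qed.

Lemma cauchy_cvg_fast :
    (forall u : nat -> V, (forall n, rnorm (u n.+1 - u n) <= 2^-1 ^+ n) ->
      exists l, forall e : R, 0 < e ->
        exists N, forall n, (N <= n)%N -> rnorm (l - u n) < e) ->
  forall F : set_system V, ProperFilter F -> cauchy F -> cvg F.
Proof.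
move=> Vc F PF /cauchyP Fc.
have /choice[u uF] n : exists x : V, F [set y | rnorm (x - y) < 2^-1 ^+ n.+2].
  have [|x xF] := Fc (2^-1 ^+ n.+2)%:C; first by rewrite ltcR exprn_gt0// invr_gt0.
  exists x; apply: filterS xF => y; by rewrite -ball_normE/= rnormE ltcR.
have [|l lu] := Vc u.
  move=> n; have [y [y1 y2]] := filter_ex (filterI (uF n) (uF n.+1)).
  apply: le_trans (rnorm_distD y _ _) _; rewrite (rnormB y).
  apply: le_trans (lerD (ltW y2) (ltW y1)) _.
  rewrite !exprS; set a := 2^-1 ^+ n; have a0 : 0 <= a by rewrite exprn_ge0// invr_ge0.
  lra.
apply/cvg_ex; exists l => U /nbhs_rnormP[e e0 eU].
have e20 : 0 < e / 2 by rewrite divr_gt0.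
have [N lN] := lu _ e20; have [m me] := exp2V_lt 1 e20.
rewrite mul1r in me.
apply: filterS (uF (maxn N m)) => y /= uy; apply: eU.
rewrite (le_lt_trans (rnorm_distD (u (maxn N m)) _ _))//.
rewrite [ltRHS](splitr e) ltrD ?lN ?leq_maxl// (lt_trans uy)//.
apply: le_lt_trans me; rewrite ler_wiXn2l// ?invr_ge0// ?invf_le1 ?ler1n//.
by rewrite (leq_trans (leq_maxr N m))// -addn2 leq_addr.
Qed.

End RealNorm.

Lemma fast_cvg (R : realType) (V : completeNormedModType R[i]) (M : R)
    (u : nat -> V) : (forall n, rnorm (u n.+1 - u n) <= M * 2^-1 ^+ n) ->
  exists l, forall e : R, 0 < e ->
    exists N, forall n, (N <= n)%N -> rnorm (l - u n) < e.
Proof.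
move=> uM; have M0 : 0 <= M.
  by have := uM 0; rewrite expr0 mulr1; exact/le_trans/rnorm_ge0.
have /cvg_ex[l ul] : cvg (u @ \oo).
  apply/cauchy_cvgP/cauchyP => eps /posC[]; set e := complex.Re _ => e0 <-.
  have [n ne] := exp2V_lt (M * 2) e0.
  exists (u n), n => // m /= nm; rewrite -ball_normE/= rnormE ltcR rnormB.
  rewrite -(subnKC nm) (le_lt_trans (fast_dist uM _ _))// (le_lt_trans _ ne)//.
  by rewrite gerBl !mulr_ge0// exprn_ge0// invr_ge0.
exists l => e e0.
have [N _ uN] : (u @ \oo) [set y | rnorm (l - y) < e].
  by apply: ul; apply/nbhs_rnormP; exists e.
by exists N.
Qed.

Section IdealAsAlgebra.
Context (R : realType) (A : banachAlgType R) (I : ideal A).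

Definition ideal_pred : pred A := fun x => `[< I x >].

Lemma ideal_predP x : reflect (I x) (x \in ideal_pred).
Proof. exact: asboolP. Qed.

Lemma ideal_pred_submod : submod_closed ideal_pred.
Proof.
have [_ I0 ID IZ _] := idealP I; split; first exact/asboolP.
by move=> c x y /asboolP Ix /asboolP Iy; apply/asboolP/ID => //; apply: IZ.
Qed.

HB.instance Definition _ := GRing.isSubmodClosed.Build R[i] A ideal_pred
  ideal_pred_submod.

Definition ideal_alg := {x : A | x \in ideal_pred}.

HB.instance Definition _ := [isSub of ideal_alg for @sval A _].
HB.instance Definition _ := [Choice of ideal_alg by <:].
HB.instance Definition _ := [SubChoice_isSubLmodule of ideal_alg by <:].

Let inorm (x : ideal_alg) : R[i] := `|\val x|.

Let inormD x y : inorm (x + y) <= inorm x + inorm y.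
Proof. exact: ler_normD. Qed.

Let inormZ (c : R[i]) x : inorm (c *: x) = `|c| * inorm x.
Proof. exact: normrZ. Qed.

Let inorm_eq0 x : inorm x = 0 -> x = 0.
Proof. by move=> /normr0_eq0 x0; apply: val_inj. Qed.

HB.instance Definition _ := Lmodule_isNormed.Build R[i] ideal_alg
  inormD inormZ inorm_eq0.

Let ideal_alg_complete (F : set_system ideal_alg) :
  ProperFilter F -> cauchy F -> cvg F.
Proof.
apply: cauchy_cvg_fast => u uf.
have [|l lu] := @fast_cvg _ A 1 (fun n => \val (u n)).
  by move=> n; rewrite mul1r; exact: uf.
have Il : l \in ideal_pred.
  apply/ideal_predP; have [/closed_rnormP cI _ _ _ _] := idealP I.
  apply: cI => e /lu[N lN]; exists (\val (u N)); last exact: lN.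
  exact/ideal_predP/(valP (u N)).
by exists (Sub l Il).
Qed.

HB.instance Definition _ := Uniform_isComplete.Build ideal_alg
  ideal_alg_complete.

Let imul_in (x y : ideal_alg) : \val x ** \val y \in ideal_pred.
Proof.
have [_ _ _ _ IM] := idealP I.
by apply/ideal_predP; have [] := IM (\val x) _ (ideal_predP _ (valP y)).
Qed.

Definition imul (x y : ideal_alg) : ideal_alg := Sub (\val x ** \val y) (imul_in x y).

Let imulA : associative imul.
Proof. by move=> x y z; apply: val_inj; rewrite /= bmulA. Qed.

Let imulDl : left_distributive imul +%R.
Proof. by move=> x y z; apply: val_inj; rewrite /= bmulDl. Qed.

Let imulDr : right_distributive imul +%R.
Proof. by move=> x y z; apply: val_inj; rewrite /= bmulDr. Qed.

Let imulZl (c : R[i]) x y : imul (c *: x) y = c *: imul x y.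
Proof. by apply: val_inj; rewrite /= bmulZl. Qed.

Let imulZr (c : R[i]) x y : imul x (c *: y) = c *: imul x y.
Proof. by apply: val_inj; rewrite /= bmulZr. Qed.

Let normr_imul x y : `|imul x y| <= `|x| * `|y|.
Proof. exact: normr_bmul. Qed.

HB.instance Definition _ := isBanachAlgebra.Build R ideal_alg
  imulA imulDl imulDr imulZl imulZr normr_imul.

End IdealAsAlgebra.

Section BanachAlgebraTheory.
Context (R : realType) (A : banachAlgType R).
Implicit Types x y z : A.

Lemma bmul0l x : 0 ** x = 0.
Proof. by have := bmulZl 0 0 x; rewrite !scale0r. Qed.

Lemma bmul0r x : x ** 0 = 0.
Proof. by have := bmulZr 0 x 0; rewrite !scale0r. Qed.

Lemma bmulNl x y : (- x) ** y = - (x ** y).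
Proof. by rewrite -scaleN1r bmulZl scaleN1r. Qed.

Lemma bmulNr x y : x ** (- y) = - (x ** y).
Proof. by rewrite -scaleN1r bmulZr scaleN1r. Qed.

Lemma bmulBl x y z : (x - y) ** z = x ** z - y ** z.
Proof. by rewrite bmulDl bmulNl. Qed.

Lemma bmulBr x y z : x ** (y - z) = x ** y - x ** z.
Proof. by rewrite bmulDr bmulNr. Qed.

Lemma rnormM x y : rnorm (x ** y) <= rnorm x * rnorm y.
Proof. by rewrite -lecR rmorphM/= -!rnormE normr_bmul. Qed.

Lemma idealN (I : ideal A) x : I x -> I (- x).
Proof. by have [_ _ _ IZ _] := idealP I; rewrite -scaleN1r; exact: IZ. Qed.

Lemma idealD (I : ideal A) x y : I x -> I y -> I (x + y).
Proof. by have [_ _ ID _ _] := idealP I; exact: ID. Qed.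

Lemma idealB (I : ideal A) x y : I x -> I y -> I (x - y).
Proof. by move=> Ix /idealN; exact: idealD. Qed.

Lemma idealZ (I : ideal A) c x : I x -> I (c *: x).
Proof. by have [_ _ _ IZ _] := idealP I; exact: IZ. Qed.

Lemma ideal0 (I : ideal A) : I 0.
Proof. by have [] := idealP I. Qed.

Lemma idealMl (I : ideal A) a x : I x -> I (a ** x).
Proof. by have [_ _ _ _ IM] := idealP I; case/(IM a). Qed.

Lemma idealMr (I : ideal A) a x : I x -> I (x ** a).
Proof. by have [_ _ _ _ IM] := idealP I; case/(IM a). Qed.

Lemma ideal_closed (I : ideal A) : closed I.
Proof. by have [] := idealP I. Qed.

End BanachAlgebraTheory.

Section QuotientAlgebra.
Context (R : realType) (A : banachAlgType R) (I : ideal A).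

(* The quotient group of MathComp; it is given below the structure of a Banach
   algebra, with the norm [q |-> inf {|x| : x in q}]. *)
Definition quot_alg := Quotient.quot (GRing.ZmodClosed.clone A (ideal_pred I) _).
HB.instance Definition _ := GRing.Zmodule.on quot_alg.

Definition quot_pi (x : A) : quot_alg := \pi_(quot_alg) x.

Lemma quot_piP x y : quot_pi x = quot_pi y <-> I (x - y).
Proof.
split=> [xy|/ideal_predP].
  by apply/ideal_predP; rewrite Quotient.idealrBE; apply/eqP.
by rewrite Quotient.idealrBE => /eqP.
Qed.

Lemma quot_pi_repr q : quot_pi (repr q) = q.
Proof. exact: reprK. Qed.

Lemma quot_piD x y : quot_pi (x + y) = quot_pi x + quot_pi y.
Proof. by rewrite /quot_pi !piE. Qed.

Lemma quot_pi0 : quot_pi 0 = 0.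
Proof. by rewrite /quot_pi !piE. Qed.

Lemma quot_piN x : quot_pi (- x) = - quot_pi x.
Proof. by rewrite /quot_pi !piE. Qed.

Lemma quot_piB x y : quot_pi (x - y) = quot_pi x - quot_pi y.
Proof. by rewrite quot_piD quot_piN. Qed.

Definition quot_scale (c : R[i]) (q : quot_alg) : quot_alg :=
  quot_pi (c *: repr q).
Definition quot_mul (p q : quot_alg) : quot_alg := quot_pi (repr p ** repr q).

Let repr_piB x : I (repr (quot_pi x) - x).
Proof. by apply/quot_piP; exact: quot_pi_repr. Qed.

Let quot_piZ' c x : quot_scale c (quot_pi x) = quot_pi (c *: x).
Proof. by apply/quot_piP; rewrite -scalerBr; exact/idealZ/repr_piB. Qed.

Let quot_piM' x y : quot_mul (quot_pi x) (quot_pi y) = quot_pi (x ** y).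
Proof.
apply/quot_piP; set x' := repr _; set y' := repr _.
have -> : x' ** y' - x ** y = (x' - x) ** y' + x ** (y' - y).
  by rewrite bmulBl bmulBr addrA subrK.
by apply: idealD; [exact/idealMr/repr_piB|exact/idealMl/repr_piB].
Qed.

Let qscalerA a b q : quot_scale a (quot_scale b q) = quot_scale (a * b) q.
Proof. by rewrite -(quot_pi_repr q) !quot_piZ' scalerA. Qed.

Let qscale1r : left_id 1 quot_scale.
Proof. by move=> q; rewrite -(quot_pi_repr q) !quot_piZ' scale1r. Qed.

Let qscalerDr : right_distributive quot_scale +%R.
Proof.
move=> a p q; rewrite -(quot_pi_repr q) -(quot_pi_repr p) -quot_piD !quot_piZ'.
by rewrite scalerDr quot_piD.
Qed.

Let qscalerDl q : {morph quot_scale^~ q : a b / a + b}.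
Proof.
by move=> a b; rewrite -(quot_pi_repr q) !quot_piZ' scalerDl quot_piD.
Qed.

HB.instance Definition _ := GRing.Zmodule_isLmodule.Build R[i] quot_alg
  qscalerA qscale1r qscalerDr qscalerDl.

Lemma quot_piZ c x : quot_pi (c *: x) = c *: quot_pi x.
Proof. by rewrite -quot_piZ'. Qed.

Definition quot_rnorm (q : quot_alg) : R :=
  inf [set rnorm x | x in [set x | quot_pi x = q]].

Let quot_rnorm_has_lb q :
  has_lbound [set rnorm x | x in [set x | quot_pi x = q]].
Proof. by exists 0 => _ [x _ <-]; exact: rnorm_ge0. Qed.

Let quot_rnorm_neq0 q : [set rnorm x | x in [set x | quot_pi x = q]] !=set0.
Proof. by exists (rnorm (repr q)), (repr q) => //=; exact: quot_pi_repr. Qed.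

Let quot_rnorm_le x : quot_rnorm (quot_pi x) <= rnorm x.
Proof. by apply: ge_inf => //; exists x. Qed.

Let quot_rnorm_lt q r : quot_rnorm q < r ->
  exists2 x, quot_pi x = q & rnorm x < r.
Proof. by move=> /inf_lt[//|_ [x xq <-] xr]; exists x. Qed.

Let quot_rnorm_ge0 q : 0 <= quot_rnorm q.
Proof. by apply: lb_le_inf => // _ [x _ <-]; exact: rnorm_ge0. Qed.

Let quot_rnormD p q : quot_rnorm (p + q) <= quot_rnorm p + quot_rnorm q.
Proof.
apply/ler_addgt0Pr => e e0; have e20 : 0 < e / 2 by rewrite divr_gt0.
have [x xp xe] : exists2 x, quot_pi x = p & rnorm x < quot_rnorm p + e / 2.
  by apply: quot_rnorm_lt; rewrite ltrDl.
have [y yq ye] : exists2 x, quot_pi x = q & rnorm x < quot_rnorm q + e / 2.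
  by apply: quot_rnorm_lt; rewrite ltrDl.
rewrite -xp -yq -quot_piD (le_trans (quot_rnorm_le _))// xp yq.
rewrite (le_trans (rnormD _ _))// (le_trans (lerD (ltW xe) (ltW ye)))//; lra.
Qed.

Let quot_rnormZ_le c q : quot_rnorm (c *: q) <= complex.Re `|c| * quot_rnorm q.
Proof.
have c0 : 0 <= complex.Re `|c| by exact: Re_norm_ge0.
apply/ler_addgt0Pr => e e0; set k := complex.Re `|c| in c0 *.
have k0 : 0 < k + 1 by rewrite ltr_wpDl.
have [x xp xe] : exists2 x, quot_pi x = q & rnorm x < quot_rnorm q + e / (k + 1).
  by apply: quot_rnorm_lt; rewrite ltrDl divr_gt0.
rewrite -xp -quot_piZ (le_trans (quot_rnorm_le _))// xp rnormZ -/k.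
rewrite (le_trans (ler_wpM2l c0 (ltW xe)))// mulrDr lerD2l mulrCA ler_piMr//.
  exact: ltW.
by rewrite ler_pdivrMr// mul1r lerDl.
Qed.

Let quot_norm (q : quot_alg) : R[i] := (quot_rnorm q)%:C.

Let quot_normD p q : quot_norm (p + q) <= quot_norm p + quot_norm q.
Proof. by rewrite -rmorphD lecR. Qed.

Let quot_normZ_le c q : quot_norm (c *: q) <= `|c| * quot_norm q.
Proof.
have -> : `|c| = (complex.Re `|c|)%:C by [].
by rewrite -rmorphM lecR.
Qed.

Let quot_normZ c q : quot_norm (c *: q) = `|c| * quot_norm q.
Proof.
apply/eqP; rewrite eq_le quot_normZ_le/=; have [->|c0] := eqVneq c 0.
  by rewrite normr0 mul0r ler0c.
rewrite -ler_pdivlMl ?normr_gt0// -normfV.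
by rewrite -[in leLHS](scalerK c0 q).
Qed.

Let quot_norm_eq0 q : quot_norm q = 0 -> q = 0.
Proof.
move=> [q0]; rewrite -(quot_pi_repr q) -quot_pi0; apply/quot_piP; rewrite subr0.
apply: (iffLR (closed_rnormP _) (@ideal_closed _ _ I)) => e.
rewrite -q0 => /quot_rnorm_lt[x xq xe]; exists (repr q - x).
  by apply/quot_piP; rewrite quot_pi_repr.
by rewrite opprB addrC subrK.
Qed.

HB.instance Definition _ := Lmodule_isNormed.Build R[i] quot_alg
  quot_normD quot_normZ quot_norm_eq0.

Lemma quot_rnormE q : rnorm q = quot_rnorm q.
Proof. by []. Qed.

Lemma rnorm_quot_pi x : rnorm (quot_pi x) <= rnorm x.
Proof. exact: quot_rnorm_le. Qed.

Lemma rnorm_quot_lt q r : rnorm q < r -> exists2 x, quot_pi x = q & rnorm x < r.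
Proof. exact: quot_rnorm_lt. Qed.

Let quot_alg_complete (F : set_system quot_alg) :
  ProperFilter F -> cauchy F -> cvg F.
Proof.
apply: cauchy_cvg_fast => q qf.
have /choice[d dP] n : exists x : A,
    quot_pi x = q n.+1 - q n /\ rnorm x < 2 * 2^-1 ^+ n.
  have [|x xq xn] := @rnorm_quot_lt (q n.+1 - q n) (2 * 2^-1 ^+ n); last by exists x.
  by rewrite (le_lt_trans (qf n))// ltr_pMl ?exprn_gt0 ?invr_gt0// ltr1n.
pose u n := repr (q 0) + \sum_(i < n) d i.
have uS n : u n.+1 = u n + d n by rewrite /u big_ord_recr addrA.
have uq n : quot_pi (u n) = q n.
  elim: n => [|n IHn]; first by rewrite /u big_ord0 addr0 quot_pi_repr.
  by rewrite uS quot_piD IHn (dP n).1 addrC subrK.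
have [|l lu] := @fast_cvg _ A 2 u.
  by move=> n; rewrite uS addrAC subrr add0r; exact/ltW/(dP n).2.
exists (quot_pi l) => e /lu[N lN]; exists N => n /lN.
by apply: le_lt_trans; rewrite -uq -quot_piB rnorm_quot_pi.
Qed.

HB.instance Definition _ := Uniform_isComplete.Build quot_alg quot_alg_complete.

Let qmulA : associative quot_mul.
Proof.
move=> p q r; rewrite -(quot_pi_repr p) -(quot_pi_repr q) -(quot_pi_repr r).
by rewrite !quot_piM' bmulA.
Qed.

Let qmulDl : left_distributive quot_mul +%R.
Proof.
move=> p q r; rewrite -(quot_pi_repr p) -(quot_pi_repr q) -(quot_pi_repr r).
by rewrite -quot_piD !quot_piM' bmulDl quot_piD.
Qed.

Let qmulDr : right_distributive quot_mul +%R.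
Proof.
move=> p q r; rewrite -(quot_pi_repr p) -(quot_pi_repr q) -(quot_pi_repr r).
by rewrite -quot_piD !quot_piM' bmulDr quot_piD.
Qed.

Let qmulZl (c : R[i]) p q : quot_mul (c *: p) q = c *: quot_mul p q.
Proof.
rewrite -(quot_pi_repr p) -(quot_pi_repr q).
by rewrite -quot_piZ !quot_piM' bmulZl quot_piZ.
Qed.

Let qmulZr (c : R[i]) p q : quot_mul p (c *: q) = c *: quot_mul p q.
Proof.
rewrite -(quot_pi_repr p) -(quot_pi_repr q).
by rewrite -quot_piZ !quot_piM' bmulZr quot_piZ.
Qed.

Let normr_qmul p q : `|quot_mul p q| <= `|p| * `|q|.
Proof.
rewrite !rnormE -rmorphM lecR.
have H e : 0 < e -> rnorm (quot_mul p q) <= (rnorm p + e) * (rnorm q + e).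
  move=> e0.
  have [|x xp xe] := @rnorm_quot_lt p (rnorm p + e); first by rewrite ltrDl.
  have [|y yq ye] := @rnorm_quot_lt q (rnorm q + e); first by rewrite ltrDl.
  rewrite -xp -yq quot_piM' (le_trans (rnorm_quot_pi _))//.
  rewrite (le_trans (rnormM _ _))// xp yq.
  by apply: ler_pM; rewrite ?rnorm_ge0 ?ltW.
apply/ler_addgt0Pr => e e0.
set a := rnorm p in H *; set b := rnorm q in H *.
have a0 : 0 <= a by exact: rnorm_ge0.
have b0 : 0 <= b by exact: rnorm_ge0.
pose d := Num.min 1 (e / (a + b + 1)).
have ab0 : 0 < a + b + 1 by lra.
have d0 : 0 < d by rewrite lt_min ltr01 divr_gt0.
apply: (le_trans (H d d0)).
have d1 : d <= 1 by rewrite ge_min lexx.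
have : d * (a + b + 1) <= e.
  by rewrite -ler_pdivlMr// ge_min lexx orbT.
nra.
Qed.

HB.instance Definition _ := isBanachAlgebra.Build R quot_alg
  qmulA qmulDl qmulDr qmulZl qmulZr normr_qmul.

Lemma quot_piM x y : quot_pi (x ** y) = quot_pi x ** quot_pi y.
Proof. by rewrite -quot_piM'. Qed.

End QuotientAlgebra.

Definition compact_operator (K : numFieldType) (V W : normedModType K)
    (T : V -> W) : Prop :=
  precompact (T @` [set x | `|x| <= 1]).

Definition compact_element (R : realType) (B : banachAlgType R) (a : B) : Prop :=
  compact_operator (fun x : B => a ** x ** a).

Definition hypocompact (R : realType) (B : banachAlgType R) : Prop :=
  forall I : ideal B, (exists q : quot_alg I, q != 0) ->
    exists q : quot_alg I, q != 0 /\ compact_element q.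

Definition hypocompact_ideal (R : realType) (A : banachAlgType R)
    (I : ideal A) : Prop :=
  hypocompact (ideal_alg I).

Definition largest_hypocompact_ideal (R : realType) (A : banachAlgType R)
    (I : ideal A) : Prop :=
  hypocompact_ideal I /\ forall J : ideal A, hypocompact_ideal J -> J `<=` I.

Section LargestHypocompactIdeal.
Context (R : realType).

Lemma compact_element_transfer (C B : banachAlgType R) (phi : C -> B)
    (c : C) (b : B) (M : R) :
    (forall u v, rnorm (phi u - phi v) <= rnorm (u - v)) ->
    compact_element c ->
    (forall q, rnorm q <= 1 ->
      exists2 u, rnorm u <= M & b ** q ** b = phi (c ** u ** c)) ->
  compact_element b.
Proof.
move=> phi1 cc bphi; pose N := Num.max M 1.
have N0 : 0 < N by rewrite lt_max ltr01 orbT.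
have NC0 : N%:C != 0 :> R[i].
  by apply/eqP => -[N00]; rewrite N00 ltxx in N0.
pose g (v : C) := phi (N%:C *: v).
have gc : continuous g.
  move=> v U /nbhs_rnormP[e e0 eU]; apply/nbhs_rnormP.
  exists (e / N); first by rewrite divr_gt0.
  move=> w vw; apply: eU; rewrite (le_lt_trans (phi1 _ _))//.
  rewrite -scalerBr rnormZ normc_def/= expr0n/= addr0 sqrtr_sqr gtr0_norm//.
  by rewrite mulrC -ltr_pdivlMr.
move: cc; rewrite /compact_element /compact_operator => -[K cK [Kc _]].
exists (g @` K); last first.
  have gK : compact (g @` K).
    by apply: continuous_compact => //; exact: continuous_subspaceT.
  by split => //; apply: compact_closed => //; exact: norm_hausdorff.
move=> _ [q /= q1 <-]; have [|u uM ->] := bphi q; first by rewrite -lecR -rnormE.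
exists (c ** (N%:C^-1 *: u) ** c); last first.
  by rewrite /g bmulZr bmulZl scalerKV.
apply: cK; exists (N%:C^-1 *: u) => //=.
rewrite -(ler_pM2l (_ : 0 < N%:C)) ?ltcR// mulr1 normrZ normfV.
rewrite (@ger0_norm _ N%:C) ?ler0c ?(ltW N0)// mulrA divff// mul1r rnormE lecR.
by rewrite (le_trans uM)// le_max lexx.
Qed.

Lemma compact_element0 (B : banachAlgType R) (b : B) :
  (forall q, b ** q ** b = 0) -> compact_element b.
Proof.
move=> b0; exists [set 0]; first by move=> _ [q _ <-].
by split; [exact: compact_set1|apply: compact_closed; [exact: norm_hausdorff|exact: compact_set1]].
Qed.

Inductive lin_span (A : banachAlgType R) (U : set A) : A -> Prop :=
| lin_span_in x : U x -> lin_span U x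
| lin_span0 : lin_span U 0
| lin_spanD x y : lin_span U x -> lin_span U y -> lin_span U (x + y)
| lin_spanZ (c : R[i]) x : lin_span U x -> lin_span U (c *: x).

Context (A : banachAlgType R).

(* The largest hypocompact ideal is the closed linear span of the union of all
   hypocompact ideals.  Let [J] be a hypocompact ideal not contained in an ideal
   [K] of that span [S], and let the class of [a] in [J] be a nonzero compact
   element of [J / (J & K)].  Then for all [y] in [J] the class of [a y a] in
   [S / K] is compact; if these classes all vanish, so is the class of [a x a] for
   all [x] in [S]; and if these vanish too, so is the class of [a]. *)
Definition hypocompact_union : set A :=
  \bigcup_(I in [set I : ideal A | hypocompact_ideal I]) (I : set A).

Let S := closure (lin_span hypocompact_union).

Let SP x : S x <->
  forall e : R, 0 < e -> exists2 y, lin_span hypocompact_union y & rnorm (x - y) < e.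
Proof.
split=> [Sx e e0|Sx U /nbhs_rnormP[e /Sx[y Uy xy] eU]].
  have [|y [Uy xy]] := Sx [set y | rnorm (x - y) < e]; last by exists y.
  by apply/nbhs_rnormP; exists e.
by exists y; split => //; apply: eU.
Qed.

Let span_mul a x : lin_span hypocompact_union x ->
  lin_span hypocompact_union (a ** x) /\ lin_span hypocompact_union (x ** a).
Proof.
elim=> [{}x [I Ih Ix]||{}x y _ [? ?] _ [? ?]|c {}x _ [? ?]].
- by split; apply: lin_span_in; exists I => //; [exact: idealMl|exact: idealMr].
- by rewrite bmul0l bmul0r; split; exact: lin_span0.
- by rewrite bmulDl bmulDr; split; exact: lin_spanD.
- by rewrite bmulZl bmulZr; split; exact: lin_spanZ.
Qed.

Let S_ideal : is_ideal S.
Proof.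
have aux (k e : R) : 0 <= k -> 0 < e -> exists2 d, 0 < d & k * d < e.
  move=> k0 e0; have k1 : 0 < k + 1 by rewrite ltr_wpDl.
  exists (e / (k + 1)); first by rewrite divr_gt0.
  by rewrite mulrA ltr_pdivrMr// mulrC ltr_pM2l// ltrDl.
split.
- exact: closed_closure.
- by apply/SP => e e0; exists 0; [exact: lin_span0|rewrite subrr rnorm0].
- move=> x y /SP Sx /SP Sy; apply/SP => e e0.
  have e20 : 0 < e / 2 by rewrite divr_gt0.
  have [x' Ux xx'] := Sx _ e20; have [y' Uy yy'] := Sy _ e20.
  exists (x' + y'); first exact: lin_spanD.
  rewrite opprD addrACA (le_lt_trans (rnormD _ _))//.
  by rewrite [ltRHS](splitr e) ltrD.
- move=> c x /SP Sx; apply/SP => e e0.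
  have [|d d0 de] := aux (complex.Re `|c|) e _ e0.
    exact: Re_norm_ge0.
  have [x' Ux xx'] := Sx _ d0; exists (c *: x'); first exact: lin_spanZ.
  rewrite -scalerBr rnormZ (le_lt_trans _ de)//.
  by rewrite ler_wpM2l ?Re_norm_ge0// ltW.
- move=> a x /SP Sx; split; apply/SP => e e0.
  + have [d d0 de] := aux _ e (rnorm_ge0 a) e0.
    have [x' /(span_mul a)[Ux _] xx'] := Sx _ d0; exists (a ** x') => //.
    rewrite -bmulBr (le_lt_trans (rnormM _ _))// (le_lt_trans _ de)//.
    by rewrite ler_wpM2l ?rnorm_ge0// ltW.
  + have [d d0 de] := aux _ e (rnorm_ge0 a) e0.
    have [x' /(span_mul a)[_ Ux] xx'] := Sx _ d0; exists (x' ** a) => //.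
    rewrite -bmulBl (le_lt_trans (rnormM _ _))// (le_lt_trans _ de)//.
    by rewrite mulrC ler_wpM2l ?rnorm_ge0// ltW.
Qed.

Let SI : ideal A := Ideal S_ideal.

Let le_SI (J : ideal A) : hypocompact_ideal J -> J `<=` SI.
Proof.
by move=> Jh x Jx; apply: subset_closure; apply: lin_span_in; exists J.
Qed.

(* If every hypocompact ideal lies in [K], then so does [S]. *)
Let SI_sub (K : ideal (ideal_alg SI)) :
    (forall J : ideal A, hypocompact_ideal J ->
      forall x : ideal_alg SI, J (\val x) -> K x) ->
  forall x, K x.
Proof.
move=> HK x.
have spanK y : lin_span hypocompact_union y ->
    exists2 z : ideal_alg SI, \val z = y & K z.
  elim=> [{}y [J Jh Jy]||{}y z _ [y' <- Ky] _ [z' <- Kz]|c {}y _ [y' <- Ky]].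
  - have Sy : y \in ideal_pred SI by apply/ideal_predP; exact: le_SI Jy.
    by exists (Sub y Sy); rewrite ?SubK//; apply: HK Jh _ _; rewrite SubK.
  - by exists 0 => //; exact: ideal0.
  - by exists (y' + z') => //; exact: idealD.
  - by exists (c *: y') => //; exact: idealZ.
apply: (iffLR (closed_rnormP _) (@ideal_closed _ _ K)) => e e0.
have /SP/(_ _ e0)[y /spanK[z <- Kz] xz] : S (\val x).
  exact/(ideal_predP SI)/(valP x).
by exists z.
Qed.

Let SI_hypocompact : hypocompact_ideal SI.
Proof.
move=> K [q0 q00].
have [J Jh [x0 Jx0 Kx0]] : exists2 J : ideal A, hypocompact_ideal J &
    exists2 x : ideal_alg SI, J (\val x) & ~ K x.
  apply: contrapT => H; move: q00; rewrite -(quot_pi_repr q0) => /eqP; apply.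
  rewrite -quot_pi0; apply/quot_piP; rewrite subr0; apply: SI_sub => J Jh x Jx.
  by apply: contrapT => Kx; apply: H; exists J => //; exists x.
have inSI (x : ideal_alg J) : \val x \in ideal_pred SI.
  by apply/ideal_predP; apply: (le_SI Jh); exact/ideal_predP/(valP x).
pose inc (x : ideal_alg J) : ideal_alg SI := Sub (\val x) (inSI x).
have incD x y : inc (x + y) = inc x + inc y by exact: val_inj.
have incB x y : inc (x - y) = inc x - inc y by exact: val_inj.
have incZ c x : inc (c *: x) = c *: inc x by exact: val_inj.
have incM x y : inc (x ** y) = inc x ** inc y by exact: val_inj.
have L_ideal : is_ideal [set x | K (inc x)].
  split.
  - apply/closed_rnormP => x xK.
    apply: (iffLR (closed_rnormP _) (@ideal_closed _ _ K)) => e /xK[y Ky xy].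
    by exists (inc y).
  - by rewrite /= (_ : inc 0 = 0); [exact: ideal0|exact: val_inj].
  - by move=> x y /= Kx Ky; rewrite incD; exact: idealD.
  - by move=> c x /= Kx; rewrite incZ; exact: idealZ.
  - by move=> a x /= Kx; rewrite !incM; split; [exact: idealMl|exact: idealMr].
pose L : ideal (ideal_alg J) := Ideal L_ideal.
have [|c [c0 cc]] := Jh L.
  exists (quot_pi L (Sub (\val x0) (introT (ideal_predP J _) Jx0))).
  apply/eqP; rewrite -quot_pi0 => /quot_piP; rewrite subr0 /L/= => Kx.
  by apply: Kx0; rewrite (_ : x0 = inc (Sub (\val x0) (introT (ideal_predP J _) Jx0))); last exact: val_inj.
pose a := repr c; pose b := inc a.
have Kb : ~ K b.
  move=> Kb; move/eqP: c0; apply; rewrite -(quot_pi_repr c) -quot_pi0.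
  by apply/quot_piP; rewrite subr0.
pose phi (u : quot_alg L) : quot_alg K := quot_pi K (inc (repr u)).
have phiE x : phi (quot_pi L x) = quot_pi K (inc x).
  apply/quot_piP; rewrite -incB; suff : L (repr (quot_pi L x) - x) by [].
  exact: (iffLR (quot_piP _ _ _) (quot_pi_repr _)).
have phi1 u v : rnorm (phi u - phi v) <= rnorm (u - v).
  rewrite -(quot_pi_repr u) -(quot_pi_repr v) !phiE -!quot_piB -incB.
  apply/ler_addgt0Pr => e e0; set w := repr u - repr v.
  have [|x xw xe] := @rnorm_quot_lt _ _ _ (quot_pi L w) (rnorm (quot_pi L w) + e).
    by rewrite ltrDl.
  by rewrite -phiE -xw phiE (le_trans (rnorm_quot_pi _ _))// xw ltW.
have lift (x : ideal_alg SI) (y : ideal_alg J) :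
    exists2 z : ideal_alg J, inc z = inc y ** x & rnorm z <= rnorm y * rnorm x.
  have Jz : \val y ** \val x \in ideal_pred J.
    by apply/ideal_predP/idealMr/ideal_predP/(valP y).
  by exists (Sub (\val y ** \val x) Jz); [exact: val_inj|exact: (rnormM (\val y) (\val x))].
have piK x : (quot_pi K x == 0) = `[< K x >].
  rewrite -(quot_pi0 K); apply/eqP/asboolP => [/quot_piP|Kx]; first by rewrite subr0.
  by apply/quot_piP; rewrite subr0.
have [[y Ky]|Hy] := pselect (exists y : ideal_alg J, ~ K (b ** inc y ** b)).
  exists (quot_pi K (b ** inc y ** b)); split; first by rewrite piK; apply/asboolP.
  apply: (@compact_element_transfer (quot_alg L) _ phi c _
    (rnorm (y ** a) * 2 * rnorm (a ** y)) phi1 cc) => q q1.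
  have [|x <- x2] := @rnorm_quot_lt _ _ _ q 2; first by rewrite (le_lt_trans q1)// ltr1n.
  have [z zE zle] := lift x (y ** a).
  exists (quot_pi L (z ** (a ** y))).
    rewrite (le_trans (rnorm_quot_pi _ _))// (le_trans (rnormM _ _))//.
    rewrite ler_wpM2r ?rnorm_ge0// (le_trans zle)// ler_wpM2l ?rnorm_ge0//.
    exact: ltW.
  have -> : c ** quot_pi L (z ** (a ** y)) ** c =
      quot_pi L (a ** (z ** (a ** y)) ** a).
    by rewrite 2!(quot_piM L) quot_pi_repr.
  rewrite -!quot_piM phiE; congr (quot_pi K _).
  by rewrite !incM zE incM -/b !bmulA.
have {}Hy y : K (b ** inc y ** b) by apply: contrapT => Ky; apply: Hy; exists y.
have [[x Kx]|Hx] := pselect (exists x, ~ K (b ** x ** b)).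
  exists (quot_pi K (b ** x ** b)); split; first by rewrite piK; apply/asboolP.
  apply: compact_element0 => // q; rewrite -(quot_pi_repr q) -!quot_piM.
  apply/eqP; rewrite piK; apply/asboolP.
  have Jw : \val (x ** b ** repr q ** b ** x) \in ideal_pred J.
    apply/ideal_predP; rewrite /=; apply: idealMr; apply: idealMl.
    exact/ideal_predP/(valP a).
  have -> : b ** x ** b ** repr q ** (b ** x ** b) = b ** inc (Sub (\val (x ** b ** repr q ** b ** x)) Jw) ** b.
    by apply: val_inj; rewrite /= !bmulA.
  exact: Hy.
exists (quot_pi K b); split; first by rewrite piK; apply/asboolP.
apply: compact_element0 => // q; rewrite -(quot_pi_repr q) -!quot_piM.
apply/eqP; rewrite piK; apply/asboolP; apply: contrapT => Kx; apply: Hx.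
by exists (repr q).
Qed.

Lemma largest_hypocompact_ideal_exists :
  exists I : ideal A, largest_hypocompact_ideal I.
Proof. by exists SI; split => //; exact: le_SI. Qed.

End LargestHypocompactIdeal.

Section Radical.
Context (R : realType).

Definition Rhc (A : banachAlgType R) : ideal A :=
  projT1 (cid (largest_hypocompact_ideal_exists A)).

Lemma RhcP (A : banachAlgType R) : largest_hypocompact_ideal (Rhc A).
Proof. exact: projT2 (cid (largest_hypocompact_ideal_exists A)). Qed.

(* In [radical_ideal], [P (ideal_alg J)] is a subset of the subtype
   [ideal_alg J]; [\val] is the inclusion of [J] into [A]. *)
Record hereditary_topological_radical
    (P : forall A : banachAlgType R, ideal A) : Prop := {
  radical_quot : forall A : banachAlgType R,
    (P (quot_alg (P A)) : set _) = [set 0];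
  radical_ideal : forall (A : banachAlgType R) (J : ideal A),
    [set \val x | x in (P (ideal_alg J) : set _)] = (J : set A) `&` P A;
  radical_morph : forall (A B : banachAlgType R) (f : {linear A -> B}),
    (forall x y : A, f (x ** y) = f x ** f y) ->
    continuous f -> (forall b : B, exists a : A, f a = b) ->
    [set f x | x in (P A : set A)] `<=` P B
}.

End Radical.

(* Main.v *)
From HB Require Import structures.
From mathcomp Require Import all_boot all_order all_algebra.
From mathcomp Require Import complex ring lra.
From mathcomp Require Import all_classical all_reals.
From mathcomp Require Import topology normedtype sequences.
Require Import Defs.

Set Implicit Arguments.
Unset Strict Implicit.
Unset Printing Implicit Defensive.

Import Order.TTheory GRing.Theory Num.Theory.
Import numFieldNormedType.Exports.

Local Open Scope classical_set_scope.
Local Open Scope ring_scope.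
Local Open Scope complex_scope.

(** Hypocompactness of [A] asks for a nonzero compact element in every nonzero
    quotient [A / K].  If [A / K] is not semiprime, it has an element [t <> 0]
    with [t ** x ** t = 0] for all [x], which is trivially compact; so only
    semiprime quotients matter ([hypocompact_semiprime]).  This removes the main
    obstacle of the subject, that an ideal of an ideal of [B] need not be an ideal
    of [B]: with a semiprime quotient it is one ([semiprime_ideal_trans]).

    Compact elements are transported by [hypocompact_hom_compact].  Let [g] be a
    nonzero bounded homomorphism from a hypocompact algebra [Q] to [T], and let
    [a] represent a nonzero compact element of [Q] modulo the kernel of [g].  The
    image of [a] need not be compact, since the unit ball of [T] is not covered by
    the image of a ball.  But if products [g y ** t ** g z] lift to [Q] with a
    bound on the norm, then every [g (a ** y ** a)] is compact, because
    [g (a ** y ** a) ** t ** g (a ** y ** a)] is the image of [a ** w ** a] for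
    some [w] of bounded norm.  A semiprimeness condition makes one of these
    elements nonzero.

    The properties of a radical follow.
    - If the image of [g : Q -> B] is an ideal of some ideal [J] of [B] that
      contains it, with bounded lifts of products, the ideal of [B] that it
      generates is hypocompact ([image_sub_Rhc]).  For [J = B] and a surjection
      [f : A -> B] this gives the property of images, and for [Q] the radical of
      [J] it gives the inclusion of this radical in that of [A].
    - The other inclusion holds because ideals of hypocompact algebras are
      hypocompact ([hypocompact_ideal_alg]).
    - The radical of the quotient vanishes because an extension of a hypocompact
      algebra by another one is hypocompact ([Rhc_quot]).

    Bounds on lifts along surjections come from the open mapping theorem, proved
    by the Baire category argument. *)

(** * Bounded linear maps *)

Section BoundedLinear.
Context (R : realType).
Implicit Types U V W : normedModType R[i].

Record bounded_linear V W (f : V -> W) : Prop := BoundedLinear {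
  bl_linear : linear f;
  bl_bounded : exists C : R, forall x, rnorm (f x) <= C * rnorm x
}.

Lemma bl_bound_gt0 V W (f : V -> W) : bounded_linear f ->
  exists2 C : R, 0 < C & forall x, rnorm (f x) <= C * rnorm x.
Proof.
move=> [_ [C fC]]; exists (Num.max C 1); first by rewrite lt_max ltr01 orbT.
move=> x; apply: le_trans (fC x) _.
by rewrite ler_wpM2r ?rnorm_ge0// le_max lexx.
Qed.

Section Morph.
Context V W (f : V -> W) (fl : linear f).
Let F : {linear V -> W} := HB.pack f (GRing.isLinear.Build _ _ _ _ f fl).

Lemma lin0 : f 0 = 0. Proof. exact: (linear0 F). Qed.
Lemma linD x y : f (x + y) = f x + f y. Proof. exact: (linearD F). Qed.
Lemma linB x y : f (x - y) = f x - f y. Proof. exact: (linearB F). Qed.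
Lemma linZ c x : f (c *: x) = c *: f x. Proof. exact: (linearZ_LR F). Qed.
End Morph.

Lemma bl_comp U V W (f : V -> W) (g : U -> V) :
  bounded_linear f -> bounded_linear g -> bounded_linear (f \o g).
Proof.
move=> fb gb; have [C C0 fC] := bl_bound_gt0 fb; have [D _ gD] := bl_bound_gt0 gb.
split; first by move=> c x y; rewrite /= (bl_linear gb) (bl_linear fb).
exists (C * D) => x; apply: le_trans (fC _) _.
by rewrite -mulrA ler_pM2l.
Qed.

Lemma continuous_bl V W (f : {linear V -> W}) : continuous f -> bounded_linear f.
Proof.
move=> /linear_bounded_continuous/linear_boundedP/pinfty_ex_gt0[C].
move=> /posC[C0 <-] fC; split; first exact: linearP.
exists (complex.Re C) => x.
by have := fC x; rewrite !rnormE -rmorphM lecR.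
Qed.

Lemma bl_closed_preimage V W (f : V -> W) (K : set W) :
  bounded_linear f -> closed K -> closed [set x | K (f x)].
Proof.
move=> fb /closed_rnormP Kc; have [C C0 fC] := bl_bound_gt0 fb.
apply/closed_rnormP => x xK; apply: Kc => e e0.
have [|y Ky xy] := xK (e / C); first by rewrite divr_gt0.
exists (f y) => //; rewrite -(linB (bl_linear fb)).
by apply: le_lt_trans (fC _) _; rewrite mulrC -ltr_pdivlMr.
Qed.

Lemma eq_of_rnorm_dist V (x y : V) :
  (forall e : R, 0 < e -> rnorm (x - y) <= e) -> x = y.
Proof.
move=> xy; apply/eqP; rewrite -subr_eq0; apply/eqP/rnorm_eq0/le_anti.
by rewrite rnorm_ge0 andbT; apply/ler_addgt0Pr => e /xy; rewrite add0r.
Qed.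

End BoundedLinear.

(** * The open mapping theorem *)

Section OpenMapping.
Context (R : realType) (V W : completeNormedModType R[i]).

(** The Baire category theorem in the form used below.  If no [F n] were dense in a
    ball, each ball would contain a smaller one that avoids [F n]; the common
    point of a nested sequence of such balls would lie in no [F n]. *)
Lemma baire_cover (F : nat -> set W) : (forall y, exists n, F n y) ->
  exists n y, exists2 r : R, 0 < r &
    forall z, rnorm (z - y) < r ->
      forall d : R, 0 < d -> exists2 x, F n x & rnorm (x - z) < d.
Proof.
move=> Fcover; apply: contrapT => Fmeagre.
have hole n (s : W * R) : exists t : W * R, 0 < s.2 ->
    [/\ 0 < t.2, t.2 <= s.2 / 4, rnorm (t.1 - s.1) <= s.2 / 4 &
        forall x, F n x -> t.2 <= rnorm (x - t.1)].
  have [s0|] := ltP 0 s.2; last by exists s.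
  have s40 : 0 < s.2 / 4 by rewrite divr_gt0.
  apply: contrapT => Ft; apply: Fmeagre; exists n, s.1, (s.2 / 4) => //.
  move=> z zs d d0; apply: contrapT => Fd; apply: Ft.
  exists (z, Num.min d (s.2 / 4)) => _ /=; split => //.
  - by rewrite lt_min d0.
  - by rewrite ge_min lexx orbT.
  - exact: ltW.
  - move=> x Fx; rewrite leNgt; apply/negP; rewrite lt_min => /andP[xd _].
    by apply: Fd; exists x.
have /choice[t tP] : forall ns : nat * (W * R), exists t : W * R, 0 < ns.2.2 ->
    [/\ 0 < t.2, t.2 <= ns.2.2 / 4, rnorm (t.1 - ns.2.1) <= ns.2.2 / 4 &
        forall x, F ns.1 x -> t.2 <= rnorm (x - t.1)].
  by case=> n s; exact: hole.
pose s := fix s n := if n is m.+1 then t (m, s m) else (0 : W, 1 : R).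
have s0 n : 0 < (s n).2.
  by elim: n => [|n IHn] /=; [exact: ltr01|have [] := tP (n, s n) IHn].
have s2 n : (s n).2 <= 1 * 2^-1 ^+ n.
  elim: n => [|n IHn]; first by rewrite expr0 mulr1.
  have [_ + _ _] := tP (n, s n) (s0 n); rewrite exprS -/(s n.+1) /= => sn.
  rewrite mul1r in IHn; have := s0 n; lra.
have [l sl] : exists l, forall e : R, 0 < e ->
    exists N, forall n, (N <= n)%N -> rnorm (l - (s n).1) < e.
  apply: (@fast_cvg _ _ 1) => n; have [_ _ + _] := tP (n, s n) (s0 n).
  by rewrite -/(s n.+1) /= => sn; have := s2 n; have := s0 n; lra.
(* As the radii shrink by a factor 4, the centres from rank [n] on stay within
   half of the [n]-th radius, hence so does the limit [l]. *)
have tail k n : rnorm ((s (n + k)%N).1 - (s n).1) <= (s n).2 / 2.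
  elim: k n => [|k IHk] n.
    by rewrite addn0 subrr rnorm0 divr_ge0// ltW.
  rewrite addnS -addSn; apply: le_trans (rnorm_distD (s n.+1).1 _ _) _.
  have [_ + + _] := tP (n, s n) (s0 n); rewrite -/(s n.+1) /= => sn1 sn2.
  have := IHk n.+1; have := s0 n; lra.
have [n Fl] := Fcover l.
have [_ _ _ /(_ _ Fl)] := tP (n, s n) (s0 n); rewrite -/(s n.+1).
apply/negP; rewrite -ltNge.
have [|N lN] := sl ((s n.+1).2 / 2); first by rewrite divr_gt0.
apply: le_lt_trans (rnorm_distD (s (n.+1 + N)%N).1 _ _) _.
by rewrite [ltRHS]splitr ltr_leD// lN// leq_addl.
Qed.

Context (f : V -> W) (fb : bounded_linear f).
Context (f_surj : forall y, exists x, f x = y).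

(** The image of some ball of [V] is dense in a ball of [W]; by subtraction it may
    be centred at 0, and by homogeneity a single [M] serves for all [y]. *)
Lemma almost_open : exists2 M : R, 0 <= M &
  forall y, exists2 x, rnorm x <= M * rnorm y & rnorm (y - f x) <= rnorm y / 2.
Proof.
have fl := bl_linear fb.
have [|n [y0 [r r0 Fr]]] := @baire_cover
    (fun n => [set y | exists2 x, rnorm x <= n%:R & f x = y]).
  move=> y; have [x <-] := f_surj y.
  by exists (Num.truncn (rnorm x)).+1, x => //; exact/ltW/truncnS_gt.
have {}Fr (y : W) (d : R) : 0 < d -> rnorm y < r ->
    exists2 x, rnorm x <= 2 * n%:R & rnorm (y - f x) < d.
  move=> d0 yr; have d20 : 0 < d / 2 by rewrite divr_gt0.
  have [|_ [x1 x1n <-] x1y] := Fr (y + y0) _ _ d20; first by rewrite addrK.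
  have [|_ [x2 x2n <-] x2y] := Fr y0 _ _ d20; first by rewrite subrr rnorm0.
  exists (x1 - x2).
    by apply: le_trans (rnormD _ _) _; rewrite rnormN; lra.
  rewrite (linB fl) (_ : y - _ = (f x2 - y0) - (f x1 - (y + y0))); last first.
    rewrite !opprB [RHS]addrC -!addrA; congr (y + _).
    by rewrite [RHS]addrC -!addrA addNr addr0 addrC.
  by apply: le_lt_trans (rnormD _ _) _; rewrite rnormN; lra.
exists (4 * n%:R / r); first by rewrite divr_ge0// ?mulr_ge0// ltW.
move=> y; have [->|y_neq0] := eqVneq y 0.
  exists 0; last by rewrite (lin0 fl) subr0 rnorm0 mul0r.
  by rewrite !rnorm0 mulr0.
have y0' : 0 < rnorm y.
  rewrite lt_neqAle rnorm_ge0 andbT eq_sym.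
  by apply: contra_neq y_neq0 => /rnorm_eq0.
(* The vector [c *: y] has norm [r / 2], hence lies in the ball of radius [r]. *)
pose c := r / 2 / rnorm y; have c0 : 0 < c by rewrite !divr_gt0.
have normc (b : R) : 0 < b -> complex.Re `|b%:C| = b.
  by move=> b0; rewrite ger0_norm// ler0c ltW.
have [||x xn xy] := Fr (c%:C *: y) (c * (rnorm y / 2)).
- by rewrite mulr_gt0// divr_gt0.
- by rewrite rnormZ normc// divfK ?gt_eqF//; lra.
have cC0 : c%:C != 0 by rewrite gt_eqF// ltcR.
have cnorm (U : normedModType R[i]) (v : U) : c * rnorm v = rnorm (c%:C *: v).
  by rewrite rnormZ normc.
have xE : x = c%:C *: (c%:C^-1 *: x) by rewrite scalerKV.
exists (c%:C^-1 *: x).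
  rewrite -(ler_pM2l c0) cnorm -xE.
  apply: le_trans xn _; rewrite /c le_eqVlt; apply/orP; left; apply/eqP.
  by field; rewrite !gt_eqF.
rewrite -(ler_pM2l c0) cnorm scalerBr -(linZ fl) -xE.
exact: ltW.
Qed.

(** Iterating [almost_open] on the residuals, whose norms are halved at each step,
    writes [y] as the image of a convergent series. *)
Theorem open_mapping : exists2 M : R, 0 <= M &
  forall y, exists2 x, f x = y & rnorm x <= M * rnorm y.
Proof.
have fl := bl_linear fb; have [M M0 fM] := almost_open.
have /choice[h hP] y : exists x,
    rnorm x <= M * rnorm y /\ rnorm (y - f x) <= rnorm y / 2.
  by have [x xy yx] := fM y; exists x.
exists (M * 2); first by rewrite mulr_ge0.
move=> y; pose res n := iter n (fun z => z - f (h z)) y.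
have res_le n : rnorm (res n) <= rnorm y * 2^-1 ^+ n.
  elim: n => [|n IHn]; first by rewrite expr0 mulr1.
  have [_] := hP (res n); rewrite exprS /= -/(res n) => resn; lra.
pose u n := \sum_(i < n) h (res i).
have uS n : u n.+1 = u n + h (res n) by rewrite /u big_ord_recr.
have u_fast n : rnorm (u n.+1 - u n) <= M * rnorm y * 2^-1 ^+ n.
  rewrite uS addrAC subrr add0r -mulrA; apply: le_trans (hP _).1 _.
  exact: ler_wpM2l.
have fu n : f (u n) = y - res n.
  elim: n => [|n IHn]; first by rewrite /u big_ord0 (lin0 fl) subrr.
  by rewrite uS (linD fl) IHn /= opprB -/(res n) addrA addrAC.
have [x ux] := fast_cvg u_fast; have [C C0 fC] := bl_bound_gt0 fb.
exists x.
  apply: eq_of_rnorm_dist => e e0; have e20 : 0 < e / 2 by rewrite divr_gt0.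
  have [|N xN] := ux (e / 2 / C); first by rewrite divr_gt0.
  have [m me] := exp2V_lt (rnorm y) e20; pose n := maxn N m.
  rewrite (le_trans (rnorm_distD (f (u n)) _ _))// [leRHS]splitr lerD//.
    rewrite -(linB fl) (le_trans (fC _))// mulrC -ler_pdivlMr// ltW//.
    by rewrite xN ?leq_maxl.
  rewrite fu addrAC subrr add0r rnormN (le_trans (res_le n))//.
  apply: le_trans (ltW me); rewrite ler_wpM2l ?rnorm_ge0//.
  by rewrite ler_wiXn2l ?leq_maxr// ?invr_ge0// invf_le1// ler1n.
apply/ler_addgt0Pr => e /ux[N xN].
rewrite -[x](subrK (u N)) addrC (le_trans (rnormD _ _))//.
rewrite lerD// ?(ltW (xN _ _))//.
have := fast_dist u_fast 0 N; rewrite add0n /u big_ord0 subr0 -/(u N) expr0.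
move=> /le_trans; apply; rewrite mulr1 mulrAC gerBl.
by rewrite !mulr_ge0 ?rnorm_ge0 ?exprn_ge0// invr_ge0.
Qed.

End OpenMapping.

(** A bounded section of [f] exists by the open mapping theorem; it is not linear,
    but composing it with [h] gives a linear map, as [h] kills the kernel. *)
Lemma bl_factor (R : realType) (U V : completeNormedModType R[i])
    (W : normedModType R[i])
    (f : U -> V) (h : U -> W) :
    bounded_linear f -> (forall y, exists x, f x = y) -> bounded_linear h ->
    (forall x, f x = 0 -> h x = 0) ->
  exists2 g : V -> W, bounded_linear g & forall x, g (f x) = h x.
Proof.
move=> fb f_surj hb fh; have [M M0 fM] := open_mapping fb f_surj.
have fl := bl_linear fb; have hl := bl_linear hb.
have /choice[s sP] y : exists x, f x = y /\ rnorm x <= M * rnorm y.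
  by have [x] := fM y; exists x.
have hE x x' : f x = f x' -> h x = h x'.
  move=> ffx; apply/eqP; rewrite -subr_eq0 -(linB hl); apply/eqP/fh.
  by rewrite (linB fl) ffx subrr.
exists (h \o s); last by move=> x /=; apply: hE; rewrite (sP _).1.
split.
  move=> c x y /=; rewrite -hl; apply: hE.
  by rewrite fl !(sP _).1.
have [C C0 hC] := bl_bound_gt0 hb; exists (C * M) => y /=.
by rewrite (le_trans (hC _))// -mulrA ler_pM2l// (sP y).2.
Qed.

(** * Bounded homomorphisms *)

Section BoundedHom.
Context (R : realType).
Implicit Types A B C : banachAlgType R.

Record bounded_hom A B (f : A -> B) : Prop := BoundedHom {
  hom_bl : bounded_linear f;
  homM : forall x y, f (x ** y) = f x ** f y
}.

Lemma hom_comp A B C (f : B -> C) (g : A -> B) :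
  bounded_hom f -> bounded_hom g -> bounded_hom (f \o g).
Proof.
move=> fh gh; split; first exact: bl_comp (hom_bl fh) (hom_bl gh).
by move=> x y; rewrite /= (homM gh) (homM fh).
Qed.

Lemma hom_preimage_ideal A B (f : A -> B) (K : ideal B) :
  bounded_hom f -> is_ideal [set x | K (f x)].
Proof.
move=> fh; have fl := bl_linear (hom_bl fh); split.
- exact: bl_closed_preimage (hom_bl fh) (@ideal_closed _ _ K).
- by rewrite /= (lin0 fl); exact: ideal0.
- by move=> x y Kx Ky; rewrite /= (linD fl); exact: idealD.
- by move=> c x Kx; rewrite /= (linZ fl); exact: idealZ.
- by move=> a x /= Kx; rewrite !(homM fh); split; [exact: idealMl|exact: idealMr].
Qed.

Lemma val_hom A (I : ideal A) : bounded_hom (fun x : ideal_alg I => \val x).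
Proof.
by split; [split; [move=> c x y|exists 1 => x; rewrite mul1r]|].
Qed.

Lemma ideal_val A (I : ideal A) (x : ideal_alg I) : I (\val x).
Proof. exact/ideal_predP/(valP x). Qed.

Lemma ideal_lift A (I : ideal A) x : I x ->
  exists2 y : ideal_alg I, \val y = x & rnorm y = rnorm x.
Proof. by move=> /(ideal_predP I) Ix; exists (Sub x Ix). Qed.

Definition corestr (V : Type) B (J : ideal B) (f : V -> B)
  (fJ : forall x, J (f x)) (x : V) : ideal_alg J :=
  Sub (f x) (introT (ideal_predP J _) (fJ x)).

Lemma corestr_bl (V : normedModType R[i]) B (J : ideal B) (f : V -> B)
  (fJ : forall x, J (f x)) : bounded_linear f -> bounded_linear (corestr fJ).
Proof.
move=> [fl fb]; split; last exact: fb.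
by move=> c x y; apply: val_inj; rewrite /= fl.
Qed.

Lemma corestr_hom A B (J : ideal B) (f : A -> B) (fJ : forall x, J (f x)) :
  bounded_hom f -> bounded_hom (corestr fJ).
Proof.
move=> [fb fM]; split; first exact: corestr_bl.
by move=> x y; apply: val_inj; rewrite /= fM.
Qed.

Lemma quot_pi_hom A (I : ideal A) : bounded_hom (quot_pi I).
Proof.
split; last exact: quot_piM.
split; first by move=> c x y; rewrite quot_piD quot_piZ.
by exists 1 => x; rewrite mul1r rnorm_quot_pi.
Qed.

Lemma quot_pi_surj A (I : ideal A) q : exists x, quot_pi I x = q.
Proof. by exists (repr q); exact: quot_pi_repr. Qed.

Lemma quot_pi_eq0 A (I : ideal A) x : quot_pi I x = 0 <-> I x.
Proof. by rewrite -(quot_pi0 I) quot_piP subr0. Qed.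

(** Rescaling the argument of [phi] makes it a contraction and reduces the claim to
    [compact_element_transfer]. *)
Lemma compact_element_lipschitz A B (phi : A -> B) (a : A) (b : B) :
    bounded_linear phi -> compact_element a ->
    (exists M, forall q, rnorm q <= 1 ->
      exists2 u, rnorm u <= M & b ** q ** b = phi (a ** u ** a)) ->
  compact_element b.
Proof.
move=> phib ac [M bphi]; have [D D0 phiD] := bl_bound_gt0 phib.
have phil := bl_linear phib.
have normD (c : R) : 0 < c -> complex.Re `|c%:C| = c.
  by move=> c0; rewrite ger0_norm// ler0c ltW.
have DC0 : D%:C != 0 by rewrite gt_eqF// ltcR.
apply: (@compact_element_transfer _ _ _
  (fun x => phi (D%:C^-1 *: x)) a b (D * M)) => //.
  move=> u v; rewrite -(linB phil) -scalerBr (le_trans (phiD _))//.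
  by rewrite -{1}(normD D D0) -rnormZ scalerKV.
move=> q /bphi[u uM ->]; exists (D%:C *: u).
  by rewrite rnormZ normD// ler_pM2l.
by rewrite bmulZr bmulZl scalerA mulVf// scale1r.
Qed.

End BoundedHom.

(** * Compact elements and semiprime quotients *)

Section Hypocompact.
Context (R : realType).
Implicit Types A B Q T : banachAlgType R.

Definition semiprime A := forall t : A, (forall x, t ** x ** t = 0) -> t = 0.

Lemma semiprime_quot A (K : ideal A) : semiprime (quot_alg K) ->
  forall a, (forall x, K (a ** x ** a)) -> K a.
Proof.
move=> sK a Ka; apply/quot_pi_eq0/sK => q.
by have /quot_pi_eq0 := Ka (repr q); rewrite 2!(quot_piM K) quot_pi_repr.
Qed.

(** In a quotient that is not semiprime, a nonzero [t] with [t ** x ** t = 0] for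
    all [x] is a compact element, since its operator is zero. *)
Lemma hypocompact_semiprime A :
    (forall K : ideal A, semiprime (quot_alg K) -> (exists x, ~ K x) ->
      exists2 q : quot_alg K, q <> 0 & compact_element q) ->
  hypocompact A.
Proof.
move=> AK K [q /eqP q0].
have [sK|/existsNP[t]] := pselect (semiprime (quot_alg K)).
  have [|p /eqP p0 pc] := AK K sK; last by exists p.
  by exists (repr q) => /quot_pi_eq0; rewrite quot_pi_repr.
move=> /not_implyP[tt0 /eqP t0]; exists t; split => //.
exact: compact_element0.
Qed.

(** The compact element is [g (a ** y ** a)], where [a] represents a nonzero compact
    element of [Q] modulo the kernel of [g]: the lift [w] of
    [g (y ** a) ** t ** g (a ** y)] gives
    [g (a ** y ** a) ** t ** g (a ** y ** a) = g (a ** w ** a)].  The condition on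
    triple products yields a [y] for which it is nonzero. *)
Lemma hypocompact_hom_compact Q T (g : Q -> T) : hypocompact Q -> bounded_hom g ->
    (exists x, g x <> 0) ->
    (forall a, (forall y, g (a ** y ** a) = 0) -> g a = 0) ->
    (forall y z, exists M, forall t, rnorm t <= 1 ->
      exists2 w, rnorm w <= M & g w = g y ** t ** g z) ->
  exists2 t : T, t <> 0 & compact_element t.
Proof.
move=> hQ gh [x0 gx0] gsp glift.
have L_ideal : is_ideal [set x | g x = 0].
  have gl := bl_linear (hom_bl gh); split.
  - apply: (bl_closed_preimage (K := [set 0]) (hom_bl gh)).
    by apply: compact_closed; [exact: norm_hausdorff|exact: compact_set1].
  - exact: (lin0 gl).
  - by move=> x y /= gx gy; rewrite (linD gl) gx gy addr0.
  - by move=> c x /= gx; rewrite (linZ gl) gx scaler0.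
  - by move=> a x /= gx; rewrite !(homM gh) gx bmul0l bmul0r.
pose L := Ideal L_ideal.
have [|c [c0 cc]] := hQ L.
  by exists (quot_pi L x0); apply/eqP => /quot_pi_eq0.
have [phi phib phiE] : exists2 phi : quot_alg L -> T, bounded_linear phi &
    forall x, phi (quot_pi L x) = g x.
  apply: bl_factor (hom_bl gh) _ => //.
  - exact: hom_bl (quot_pi_hom L).
  - exact: quot_pi_surj.
  - by move=> x /quot_pi_eq0.
pose a := repr c; have cE : c = quot_pi L a by rewrite quot_pi_repr.
have ga : g a <> 0.
  by move=> ga; move/eqP: c0; apply; rewrite cE; exact/quot_pi_eq0.
have /existsNP[y gy] : ~ forall y, g (a ** y ** a) = 0 by move=> /gsp.
exists (g (a ** y ** a)) => //; apply: compact_element_lipschitz phib cc _.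
have [M gM] := glift (y ** a) (a ** y); exists M => t /gM[w wM gw].
exists (quot_pi L w); first by rewrite (le_trans (rnorm_quot_pi _ _)).
by rewrite cE -2!(quot_piM L) phiE !(homM gh) gw !(homM gh) !bmulA.
Qed.

(** For [k] in [K] and [s] in [S], the product [(b ** k) ** s ** (b ** k)] equals
    [((b ** k) ** (s ** b)) ** k], where [s ** b] is in [S], so it belongs to [K];
    semiprimeness then gives [b ** k] in [K]. *)
Lemma semiprime_ideal_absorb B (S : ideal B) (K : ideal (ideal_alg S)) :
    semiprime (quot_alg K) -> forall (b : B) (k k' : ideal_alg S), K k ->
    \val k' = b ** \val k \/ \val k' = \val k ** b ->
  K k'.
Proof.
move=> sK b k k' Kk k'E; apply: semiprime_quot => // s.
case: k'E => k'E.
  have [z zE _] := ideal_lift (idealMr b (ideal_val s)).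
  rewrite (_ : _ ** _ = k' ** z ** k); first exact: idealMl.
  by apply: val_inj; rewrite /= zE k'E !bmulA.
have [z zE _] := ideal_lift (idealMl b (ideal_val s)).
rewrite (_ : _ ** _ = k ** (z ** k')); first exact: idealMr.
by apply: val_inj; rewrite /= zE k'E !bmulA.
Qed.

Lemma semiprime_ideal_trans B (S : ideal B) (K : ideal (ideal_alg S)) :
    semiprime (quot_alg K) ->
  exists K' : ideal B, forall x, K' x <-> exists2 k, K k & \val k = x.
Proof.
move=> sK; suff K'_ideal : is_ideal [set x | exists2 k, K k & \val k = x].
  by exists (Ideal K'_ideal).
split.
- apply/closed_rnormP => x xK.
  have Sx : S x.
    apply: (iffLR (closed_rnormP _) (@ideal_closed _ _ S)) => e.
    move=> /xK[_ [k _ <-] xk].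
    by exists (\val k) => //; exact: ideal_val.
  have [k kE _] := ideal_lift Sx; exists k => //.
  apply: (iffLR (closed_rnormP _) (@ideal_closed _ _ K)) => e.
  move=> /xK[_ [k' Kk' <-] xk].
  by exists k' => //; move: xk; rewrite -kE.
- by exists 0 => //; exact: ideal0.
- by move=> _ _ [k Kk <-] [l Kl <-]; exists (k + l) => //; exact: idealD.
- by move=> c _ [k Kk <-]; exists (c *: k) => //; exact: idealZ.
- move=> b _ [k Kk <-].
  have [k1 k1E _] := ideal_lift (idealMl b (ideal_val k)).
  have [k2 k2E _] := ideal_lift (idealMr b (ideal_val k)).
  split; [exists k1 => //|exists k2 => //]; apply: (semiprime_ideal_absorb sK Kk).
    by left; exact: k1E.
  by right; exact: k2E.
Qed.

End Hypocompact.

(** * Ideals generated by hypocompact images, and ideals of hypocompact algebras *)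

Section Radical.
Context (R : realType).
Implicit Types A B Q : banachAlgType R.

Lemma Rhc_hypocompact A : hypocompact (ideal_alg (Rhc A)).
Proof. exact: (RhcP A).1. Qed.

Lemma sub_Rhc A (I : ideal A) : hypocompact (ideal_alg I) -> I `<=` Rhc A.
Proof. exact: (RhcP A).2. Qed.

Lemma setT_is_ideal A : is_ideal (@setT A).
Proof. by split => //; exact: closedT. Qed.

Lemma bmull_bl A (u : A) : bounded_linear (fun x => u ** x).
Proof.
split; last by exists (rnorm u) => x; exact: rnormM.
by move=> c x y; rewrite bmulDr bmulZr.
Qed.

Lemma bmulr_bl A (u : A) : bounded_linear (fun x => x ** u).
Proof.
split; last by exists (rnorm u) => x; rewrite mulrC; exact: rnormM.
by move=> c x y; rewrite bmulDl bmulZl.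
Qed.

(** The ideal [S] of [B] generated by the image of [g] is hypocompact.  A semiprime
    [K] in [S] is an ideal of [B], so it cannot contain the image unless [K] is all
    of [S].  If [K] contains [b ** g y ** b] for all [y], where [b = g a], then for
    [s] and [x] in [S] it contains
    [(b ** s ** b) ** x ** (b ** s ** b) = b ** (s ** b ** x ** b ** s) ** b],
    because [S] lies in [J], which absorbs the image of [g]; using semiprimeness
    twice, [b] is in [K]. *)
Lemma image_sub_Rhc Q B (g : Q -> B) (J : ideal B) :
    hypocompact Q -> bounded_hom g -> (forall y, J (g y)) ->
    (forall y s, J s -> exists z, g z = s ** g y) ->
    (forall y, exists M, forall s, J s ->
      exists2 z, rnorm z <= M * rnorm s & g z = g y ** s) ->
  forall y, Rhc B (g y).
Proof.
move=> hQ gh gJ absl absr.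
have absr' y s : J s -> exists z, g z = g y ** s.
  by move=> Js; have [M /(_ s Js)[z]] := absr y; exists z.
pose S0 := [set x | forall K : ideal B, (forall y, K (g y)) -> K x].
have S0_ideal : is_ideal S0.
  split.
  - apply/closed_rnormP => x xS K gK.
    apply: (iffLR (closed_rnormP _) (@ideal_closed _ _ K)) => e /xS[z Sz xz].
    by exists z => //; exact: Sz.
  - by move=> K _; exact: ideal0.
  - by move=> x z Sx Sz K gK; apply: idealD; [exact: Sx|exact: Sz].
  - by move=> c x Sx K gK; apply: idealZ; exact: Sx.
  - move=> b x Sx; split=> K gK; [apply: idealMl|apply: idealMr]; exact: Sx.
pose S : ideal B := Ideal S0_ideal.
have SJ x : S x -> J x by move=> /(_ J); apply.
have gS y : S (g y) by move=> K; apply.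
suff /sub_Rhc SR : hypocompact (ideal_alg S) by move=> y; exact/SR/gS.
apply: hypocompact_semiprime => K sK [x0 Kx0].
pose h := corestr gS.
have hh : bounded_hom h by exact: corestr_hom.
apply: (hypocompact_hom_compact (g := quot_pi K \o h) hQ).
- by apply: hom_comp => //; exact: quot_pi_hom.
- apply: contrapT => /forallNP Kg; apply: Kx0.
  have {}Kg y : K (h y) by apply/quot_pi_eq0; exact: contrapT (Kg y).
  have [K' K'P] := semiprime_ideal_trans sK.
  have Sx0 : S0 (\val x0) := ideal_val x0.
  have /K'P[k Kk /val_inj <-//] : K' (\val x0).
  by apply: Sx0 => y; apply/K'P; exists (h y).
- move=> a aQa /=; apply/quot_pi_eq0/(semiprime_quot sK) => s.
  have {}aQa y : K (h a ** h y ** h a).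
    by apply/quot_pi_eq0; have := aQa y; rewrite /= !(homM hh).
  apply: (semiprime_quot sK) => x.
  have Js := SJ _ (ideal_val s); have Jx := SJ _ (ideal_val x).
  have [y1 y1E] := absl a _ Js.
  have [y2 y2E] := absr' y1 _ Jx.
  have [y3 y3E] := absr' y2 _ (gJ a).
  have [y yE] := absr' y3 _ Js.
  rewrite (_ : _ ** _ = h a ** h y ** h a) //; apply: val_inj => /=.
  by rewrite yE y3E y2E y1E !bmulA.
- move=> y z.
  have [N N0 piN] := open_mapping (hom_bl (quot_pi_hom K)) (@quot_pi_surj _ _ K).
  have [M hM] := absr y.
  exists (Num.max M 0 * N * rnorm z) => t t1; have [s sE sN] := piN t.
  have [w wM wE] := hM _ (SJ _ (ideal_val s)).
  exists (w ** z); last first.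
    rewrite /= -sE -2!(quot_piM K); congr quot_pi; apply: val_inj.
    by rewrite /= (homM gh) wE.
  rewrite (le_trans (rnormM _ _))// ler_wpM2r ?rnorm_ge0//.
  apply: (le_trans wM); apply: (@le_trans _ _ (Num.max M 0 * rnorm s)).
    by rewrite ler_wpM2r ?rnorm_ge0// le_max lexx.
  rewrite ler_wpM2l ?le_max ?lexx ?orbT//.
  by rewrite (le_trans sN)// ler_piMr.
Qed.

(** A semiprime [K] in [I] is an ideal of [A], and so is the set [N] of the [x] that
    [I] multiplies into [K] from both sides.  Let [h] represent a nonzero compact
    element of [A / N].  Some [u] in [I] has [h ** u] or [u ** h] outside [K]; this
    element [e] is compact modulo [K] since, for instance,
    [(h ** u) ** s ** (h ** u) = (h ** (u ** s) ** h) ** u] and multiplication by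
    [u] induces a bounded map from [A / N] to [I / K]. *)
Lemma hypocompact_ideal_alg A (I : ideal A) :
  hypocompact A -> hypocompact (ideal_alg I).
Proof.
move=> hA; apply: hypocompact_semiprime => K sK [x0 Kx0].
have [K' K'P] := semiprime_ideal_trans sK.
have K'E (k : ideal_alg I) : K' (\val k) <-> K k.
  by rewrite K'P; split=> [[k' Kk' /val_inj <-]|Kk] //; exists k.
have N_ideal : is_ideal [set x | forall u, I u -> K' (u ** x) /\ K' (x ** u)].
  split.
  - apply/closed_rnormP => x xN u Iu; split.
      have K'u := bl_closed_preimage (bmull_bl u) (@ideal_closed _ _ K').
      apply: (iffLR (closed_rnormP _) K'u).
      by move=> e /xN[y Ny xy]; exists y => //; have [] := Ny u Iu.
    have K'u := bl_closed_preimage (bmulr_bl u) (@ideal_closed _ _ K').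
    apply: (iffLR (closed_rnormP _) K'u).
    by move=> e /xN[y Ny xy]; exists y => //; have [] := Ny u Iu.
  - by move=> u _; rewrite bmul0l bmul0r; split; exact: ideal0.
  - move=> x y Nx Ny u Iu; have [? ?] := Nx u Iu; have [? ?] := Ny u Iu.
    by rewrite bmulDl bmulDr; split; exact: idealD.
  - move=> c x Nx u Iu; have [? ?] := Nx u Iu.
    by rewrite bmulZl bmulZr; split; exact: idealZ.
  - move=> a x Nx; split=> u Iu; have [? ?] := Nx u Iu; split.
    + by have [] := Nx _ (idealMr a Iu); rewrite -bmulA.
    + by rewrite -bmulA; exact: idealMl.
    + by rewrite bmulA; exact: idealMr.
    + by have [] := Nx _ (idealMl a Iu); rewrite bmulA.
pose N := Ideal N_ideal.
have [|c [c0 cc]] := hA N.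
  exists (quot_pi N (\val x0)); apply/eqP => /quot_pi_eq0 Nx0; apply: Kx0.
  apply: (semiprime_quot sK) => u; apply/K'E => /=.
  by apply: idealMr; have [] := Nx0 _ (ideal_val u).
pose h := repr c; have cE : c = quot_pi N h by rewrite quot_pi_repr.
have /existsNP[u0 /not_implyP[Iu0 Kuh]] : ~ N h.
  by move=> Nh; move/eqP: c0; apply; rewrite cE; exact/quot_pi_eq0.
have [u uE _] := ideal_lift Iu0; rewrite -uE in Kuh.
have Iul x : I (\val u ** x) by apply: idealMr; exact: ideal_val.
have Iur x : I (x ** \val u) by apply: idealMl; exact: ideal_val.
(* The argument common to [e = h ** u] and [e = u ** h]; [psi] is the
   multiplication by [u] on the other side of [h]. *)
have compact_of_mul (e : ideal_alg I) (psi : A -> ideal_alg I) :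
    ~ K e -> bounded_linear psi ->
    (forall x, N x -> K (psi x)) ->
    (exists2 C : R, 0 <= C & forall s : ideal_alg I,
      exists2 x : A, rnorm x <= C * rnorm s & e ** s ** e = psi (h ** x ** h)) ->
  exists2 q : quot_alg K, q <> 0 & compact_element q.
  move=> Ke psib Npsi [C C0 elift].
  have [phi phib phiE] : exists2 phi : quot_alg N -> quot_alg K,
      bounded_linear phi & forall x, phi (quot_pi N x) = quot_pi K (psi x).
    apply: bl_factor (bl_comp (hom_bl (quot_pi_hom K)) psib) _ => //.
    - exact: hom_bl (quot_pi_hom N).
    - exact: quot_pi_surj.
    - by move=> x /quot_pi_eq0 Nx; apply/quot_pi_eq0/Npsi.
  exists (quot_pi K e); first by move=> /quot_pi_eq0.
  apply: compact_element_lipschitz phib cc _; exists (C * 2) => q q1.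
  have [|s <- s2] := @rnorm_quot_lt _ _ _ q 2.
    by rewrite (le_lt_trans q1)// ltr1n.
  have [x xC eE] := elift s; exists (quot_pi N x).
    rewrite (le_trans (rnorm_quot_pi _ _))// (le_trans xC)// ler_wpM2l//.
    exact: ltW.
  by rewrite cE -2!(quot_piM K) -2!(quot_piM N) phiE eE.
have [Kl|Kl] := pselect (K' (\val u ** h)).
  apply: (compact_of_mul (corestr Iur h) (corestr Iur)).
  - by move=> /K'E Kr; apply: Kuh.
  - exact/corestr_bl/bmulr_bl.
  - by move=> x Nx; apply/K'E; have [] := Nx _ (ideal_val u).
  - exists (rnorm (\val u)); first exact: rnorm_ge0.
    move=> s; exists (\val u ** \val s); first exact: rnormM.
    by apply: val_inj; rewrite /= !bmulA.
apply: (compact_of_mul (corestr Iul h) (corestr Iul)).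
- by move=> /K'E.
- exact/corestr_bl/bmull_bl.
- by move=> x Nx; apply/K'E; have [] := Nx _ (ideal_val u).
- exists (rnorm (\val u)); first exact: rnorm_ge0.
  move=> s; exists (\val s ** \val u); first by rewrite mulrC; exact: rnormM.
  by apply: val_inj; rewrite /= !bmulA.
Qed.

End Radical.

(** * The properties of a hereditary topological radical *)

Section RadicalProperties.
Context (R : realType).
Implicit Types A B Q : banachAlgType R.

Lemma Rhc_image A B (f : A -> B) :
  bounded_hom f -> (forall b, exists a, f a = b) ->
  forall x, Rhc A x -> Rhc B (f x).
Proof.
move=> fh f_surj x /ideal_lift[x' <- _].
have [M M0 fM] := open_mapping (hom_bl fh) f_surj.
apply: (@image_sub_Rhc R (ideal_alg (Rhc A)) B (fun x => f (\val x))
  (Ideal (setT_is_ideal B)) _ _ _ _ _ x') => //.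
- exact: Rhc_hypocompact.
- exact: hom_comp fh (val_hom _).
- move=> y s _; have [a <-] := f_surj s.
  have [z zE _] := ideal_lift (idealMl a (ideal_val y)).
  by exists z; rewrite /= zE (homM fh).
- move=> y; exists (rnorm y * M) => s _; have [a <- aM] := fM s.
  have [z zE zn] := ideal_lift (idealMr a (ideal_val y)).
  exists z; last by rewrite /= zE (homM fh).
  rewrite zn (le_trans (rnormM _ _))// -mulrA ler_wpM2l ?rnorm_ge0//.
Qed.

(** From left to right, the radical of [J] is an ideal of [J], which is all that
    [image_sub_Rhc] requires.  From right to left, the intersection of [J] with the
    radical of [A] is an ideal of a hypocompact algebra, hence hypocompact. *)
Lemma Rhc_ideal A (J : ideal A) (x : ideal_alg J) :
  Rhc (ideal_alg J) x <-> Rhc A (\val x).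
Proof.
split=> [/ideal_lift[x' <- _]|].
  apply: (@image_sub_Rhc R (ideal_alg (Rhc (ideal_alg J))) A
    (fun y => \val (\val y)) J _ _ _ _ _ x').
  - exact: Rhc_hypocompact.
  - exact: hom_comp (val_hom _) (val_hom _).
  - by move=> y; exact: ideal_val.
  - move=> y _ /ideal_lift[s <- _].
    have [z zE _] := ideal_lift (idealMl s (ideal_val y)).
    by exists z; rewrite /= zE.
  - move=> y; exists (rnorm y) => _ /ideal_lift[s <- sn].
    have [z zE zn] := ideal_lift (idealMr s (ideal_val y)).
    by exists z; rewrite /= ?zE// zn -sn; exact: rnormM.
pose I : ideal (ideal_alg (Rhc A)) :=
  Ideal (hom_preimage_ideal J (val_hom (Rhc A))).
move=> Px.
pose i (y : ideal_alg I) := \val (\val y).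
have iJ y : J (i y) by exact: ideal_val y.
have [p pE _] := ideal_lift Px.
have Ip : I p by rewrite /I /= pE; exact: ideal_val.
have [q qE _] := ideal_lift Ip.
have -> : x = corestr iJ q by apply: val_inj; rewrite /= /i qE pE.
have lift (a : A) : Rhc A a -> J a ->
    exists2 z : ideal_alg I, i z = a & rnorm z = rnorm a.
  move=> /ideal_lift[b bE bn] Ja.
  have /ideal_lift[z zE zn] : I b by rewrite /I /= bE.
  by exists z; rewrite /i ?zE// zn.
apply: (@image_sub_Rhc R (ideal_alg I) (ideal_alg J) (corestr iJ)
  (Ideal (setT_is_ideal _)) _ _ _ _ _ q) => //.
- exact/hypocompact_ideal_alg/Rhc_hypocompact.
- by apply: corestr_hom; exact: hom_comp (val_hom _) (val_hom _).
- move=> y s _; have [||z zE _] := lift (\val s ** i y).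
  + by apply: idealMl; exact: ideal_val.
  + by apply: idealMl.
  + by exists z; apply: val_inj.
- move=> y; exists (rnorm y) => s _; have [||z zE zn] := lift (i y ** \val s).
  + by apply: idealMr; exact: ideal_val.
  + by apply: idealMr.
  + by exists z; [rewrite zn; exact: rnormM|apply: val_inj].
Qed.

(** The preimage [I] in [A] of the radical [Q] of [A / P] is hypocompact.  For a
    semiprime [K] in [I], either [K] contains [P], and then [I / K] is a quotient of
    [Q], or the map from [P] to [I / K] is nonzero; both maps transport compact
    elements. *)
Lemma Rhc_quot A (q : quot_alg (Rhc A)) : Rhc (quot_alg (Rhc A)) q -> q = 0.
Proof.
set P := Rhc A; set Q := Rhc (quot_alg P) => Qq.
have hP : hypocompact (ideal_alg P) by exact: Rhc_hypocompact.
have hQ : hypocompact (ideal_alg Q) by exact: Rhc_hypocompact.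
have pih := quot_pi_hom P.
pose I : ideal A := Ideal (hom_preimage_ideal Q pih).
have PI x : P x -> I x by move=> /quot_pi_eq0 Px; rewrite /I /= Px; exact: ideal0.
suff /sub_Rhc IP : hypocompact (ideal_alg I).
  rewrite -(quot_pi_repr q); apply/quot_pi_eq0/IP.
  by rewrite /I /= quot_pi_repr.
apply: hypocompact_semiprime => K sK [x0 Kx0].
have Kh := quot_pi_hom K.
have [N N0 piN] := open_mapping (hom_bl Kh) (@quot_pi_surj _ _ K).
have [PK|] := pselect (forall x : ideal_alg I, P (\val x) -> K x).
  pose r := quot_pi P \o (fun x : ideal_alg I => \val x).
  have rQ x : Q (r x) by exact: ideal_val x.
  have rh : bounded_hom r by exact: hom_comp pih (val_hom I).
  have r_surj y : exists x, corestr rQ x = y.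
    have [x] : exists x, quot_pi P x = \val y by exact: quot_pi_surj.
    move=> xE.
    have [z zE _] : exists2 z : ideal_alg I, \val z = x & rnorm z = rnorm x.
      by apply: ideal_lift; rewrite /I /= xE; exact: ideal_val.
    by exists z; apply: val_inj; rewrite /= /r /= zE.
  have [g gb gE] : exists2 g : ideal_alg Q -> quot_alg K, bounded_linear g &
      forall x, g (corestr rQ x) = quot_pi K x.
    apply: bl_factor => //; [exact/corestr_bl/(hom_bl rh)|exact: hom_bl Kh|].
    move=> x /(congr1 \val) /= rx; apply/quot_pi_eq0/PK.
    exact/quot_pi_eq0.
  have gh : bounded_hom g.
    split=> // x y; have [x' <-] := r_surj x; have [y' <-] := r_surj y.
    by rewrite -(homM (corestr_hom rQ rh)) !gE (homM Kh).
  have g_surj t : exists y, g y = t.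
    by have [x <-] := quot_pi_surj t; exists (corestr rQ x).
  have [M M0 gM] := open_mapping gb g_surj.
  apply: (@hypocompact_hom_compact R (ideal_alg Q) (quot_alg K) g hQ gh).
  - by exists (corestr rQ x0); rewrite gE => /quot_pi_eq0.
  - move=> a ga; apply: sK => t; have [y <-] := g_surj t.
    by rewrite -!(homM gh).
  - move=> y z; exists (M * (rnorm (g y) * rnorm (g z))) => t t1.
    have [w wE wM] := gM (g y ** t ** g z); exists w => //.
    rewrite (le_trans wM)// ler_wpM2l// (le_trans (rnormM _ _))//.
    rewrite ler_wpM2r ?rnorm_ge0// (le_trans (rnormM _ _))//.
    by rewrite ler_piMr ?rnorm_ge0.
move=> /existsNP[x1 /not_implyP[Px1 Kx1]].
have valPI (y : ideal_alg P) : I (\val y) by exact/PI/ideal_val.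
pose j := corestr valPI.
have jh : bounded_hom j by apply: corestr_hom; exact: val_hom.
have liftP (x : ideal_alg I) : P (\val x) ->
    exists2 y, j y = x & rnorm y = rnorm x.
  by move=> /ideal_lift[y yE yn]; exists y => //; exact: val_inj.
apply: (@hypocompact_hom_compact R (ideal_alg P) (quot_alg K) _ hP
  (hom_comp Kh jh)).
- by have [y yE _] := liftP _ Px1; exists y; rewrite /= yE => /quot_pi_eq0.
- move=> a aPa /=; apply/quot_pi_eq0/(semiprime_quot sK) => s.
  apply: (semiprime_quot sK) => x.
  have [|y yE _] := liftP (s ** j a ** x ** j a ** s).
    by rewrite /=; do 3 apply: idealMr; apply: idealMl; exact: ideal_val.
  have := aPa y; rewrite /= !(homM jh) yE => /quot_pi_eq0.
  by rewrite !bmulA.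
- move=> y z; exists (rnorm (j y) * N * rnorm (j z)) => t t1.
  have [s sE sN] := piN t.
  have [|w wE wn] := liftP (j y ** s ** j z).
    by rewrite /=; apply: idealMl; exact: ideal_val.
  exists w; last by rewrite /= wE 2!(quot_piM K) sE.
  rewrite wn (le_trans (rnormM _ _))// ler_wpM2r ?rnorm_ge0//.
  rewrite (le_trans (rnormM _ _))// ler_wpM2l ?rnorm_ge0// (le_trans sN)//.
  by rewrite ler_piMr.
Qed.

End RadicalProperties.

Theorem theorem3p14 (R : realType) : hereditary_topological_radical (@Rhc R).
Proof.
split=> [A|A J|A B f fM fc f_surj].
- by apply/seteqP; split=> [q /Rhc_quot//|_ ->]; exact: ideal0.
- apply/seteqP; split=> [_ [x Px <-]|x [/ideal_lift[y <- _] Px]].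
    by split; [exact: ideal_val|exact/Rhc_ideal].
  by exists y => //; exact/Rhc_ideal.
- move=> _ [x Px <-]; apply: Rhc_image Px => //.
  by split => //; exact: continuous_bl.
Qed.
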